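(* For all integers $n,k\ge 0$ with $n\ge k$, $$S_{2}(n,k)=\sum_{l=k}^{n}(-1)^{n-l}S_{2}(n,l)L(l,k)$$ and $$L(n,k)=\sum_{l=k}^{n}(-1)^{n-l}S_{1}(n,l)S_{2}(l,k).$$
   Context: The Stirling numbers of the first kind $S_1(n,k)$ (signed) are defined by $(x)_n=\sum_{k=0}^n S_1(n,k)x^k$, where $(x)_0=1$ and $(x)_n=x(x-1)\cdots(x-n+1)$ for $n\ge 1$. $S_2(n,k)$ is the Stirling number of the second kind: the number of ways to partition a set of $n$ elements into $k$ nonempty subsets. The unsigned Lah number $L(n,k)$ is the number of ways a set of $n$ elements can be partitioned into $k$ nonempty linearly ordered subsets (so $L(0,0)=1$, $L(n,0)=0$ for $n\ge 1$, $L(n,k)=0$ for $k>n$, and $L(n,k)=\binom{n-1}{k-1}\frac{n!}{k!}$ for $n\ge k\ge 1$). *)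

(* Defs.v *)
From mathcomp Require Import all_boot all_order all_algebra.

Set Implicit Arguments.
Unset Strict Implicit.
Unset Printing Implicit Defensive.

Import Order.TTheory GRing.Theory Num.Theory.

Local Open Scope ring_scope.

Definition falling_poly (n : nat) : {poly int} := \prod_(i < n) ('X - (i%:Z)%:P).

Definition stirling1 (n k : nat) : int := (falling_poly n)`_k.

Definition set_partitions (T : finType) (k : nat) : {set {set {set T}}} :=
  [set P | partition P [set: T] & #|P| == k].

Definition stirling2 (n k : nat) : nat := #|set_partitions 'I_n k|.

(* A linearly ordered subset of T is encoded as the duplicate-free list of its
   elements in increasing order. Such a list has size at most #|T|, so bounding
   the size loses nothing and makes the type of lists finite. *)
Definition ordered_partitions (T : finType) (k : nat) :
    {set {set #|T|.-bseq T}} :=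
  [set Q : {set #|T|.-bseq T} |
     [&& [forall s in Q, (s != [::] :> seq T) && uniq s],
         [forall x : T, #|[set s in Q | x \in s]| == 1%N]
       & #|Q| == k]].

Definition lah (n k : nat) : nat := #|ordered_partitions 'I_n k|.

(* Main.v *)
Require Import Defs.
From mathcomp Require Import all_boot all_order all_algebra.

Import Order.TTheory GRing.Theory Num.Theory.

Local Open Scope ring_scope.

(** Both identities compare coordinates in the basis of falling factorials
    (x)_k, after expanding a power or a rising factorial
    x(x+1)...(x+n-1) in two ways. The expansions are

      x^n         = sum_k S2(n,k) (x)_k              [Xn_falling_poly],
      x(x+1)...   = sum_k L(n,k) (x)_k               [rising_falling_poly],
      x(x+1)...   = sum_l (-1)^(n-l) S1(n,l) x^l     [rising_polyE],
      x^n         = sum_l (-1)^(n-l) S2(n,l) x(x+1)...(x+l-1)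
                                                     [Xn_rising_poly].

    The last two come from the definition of S1 and from the first expansion
    by the substitution of -x for x. Rewriting the powers x^l of the third
    expansion by the first gives the formula for L(n,k); rewriting the rising
    factorials of the fourth by the second gives the formula for S2(n,k).

    The first two expansions are both proved for x = m a natural number, where
    they are instances of one double count. Sum the product of g(size) over
    all fibers of f, for f ranging over the maps from an n-set to an m-set, with
    g(0) = 1. The nonempty fibers of f form a set partition P of the n-set, and
    P arises from exactly (m)_|P| maps, since such a map is an injection of the
    blocks of P. Hence the sum is sum_k w(n,k) (m)_k, where w(n,k) is the sum
    over the partitions into k blocks of the product of g over the block sizes
    [sum_ffun_prod_fibers]. For g = 1 the sum counts all maps, m^n of them, and
    w(n,k) = S2(n,k). For g = factorial, w(n,k) = L(n,k) since a block of size
    b has b! linear orders, and the sum is m(m+1)...(m+n-1) by induction on n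
    [sum_ffun_prod_fact]. *)

(** * Maps between finite sets and their kernels *)

Definition weighted_partitions (g : nat -> nat) (T : finType) (k : nat) : nat :=
  (\sum_(P in set_partitions T k) \prod_(B in P) g #|B|)%N.

Lemma leq_card_partition (T : finType) (P : {set {set T}}) (D : {set T}) :
  partition P D -> (#|P| <= #|D|)%N.
Proof.
move=> partP; rewrite (card_partition partP) -sum1_card.
apply: leq_sum => B PB; rewrite card_gt0; apply: contraTneq PB => ->.
by case/and3P: partP.
Qed.

Lemma weighted_partitions_small g (T : finType) k :
  (#|T| < k)%N -> weighted_partitions g T k = 0%N.
Proof.
move=> ltTk; rewrite /weighted_partitions big_pred0 // => P.
rewrite inE; apply: contraTF ltTk => /andP[partP /eqP <-].
by rewrite -leqNgt -cardsT leq_card_partition.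
Qed.

(** A map with kernel partition [P] is the same thing as an injection from the
    blocks of [P], by composition with the map from points to blocks. *)
Lemma card_ffun_kernel (T U : finType) (P : {set {set T}}) :
  partition P [set: T] ->
  #|[set f : {ffun T -> U} | preim_partition f [set: T] == P]| = (#|U| ^_ #|P|)%N.
Proof.
move=> partP; have [/eqP covP tiP P0] := and3P partP.
have Pblk x : pblock P x \in P by rewrite pblock_mem ?covP ?inE.
pose D := {B | B \in P}; pose blk x : D := exist _ (pblock P x) (Pblk x).
have exB (B : D) : exists x, x \in val B.
  by apply/set0Pn; apply: contraTneq (valP B) => ->.
have blkK (B : D) x : x \in val B -> blk x = B.
  by move=> xB; apply/val_inj/(def_pblock tiP (valP B) xB).
pose extend (h : {ffun D -> U}) := [ffun x => h (blk x)].
have extend_inj : injective extend.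
  move=> h1 h2 eqh; apply/ffunP=> B; have [x xB] := exB B.
  by have := congr1 (fun f : {ffun T -> U} => f x) eqh; rewrite !ffunE (blkK B).
transitivity #|[set extend h | h in [set h : {ffun D -> U} | injectiveb h]]|.
  congr #|pred_of_set _|; apply/setP=> f; rewrite inE; apply/eqP/imsetP=> [kerf | [h]].
    have kerE x y : (y \in pblock P x) = (f x == f y).
      rewrite -kerf pblock_equivalence_partition ?inE //.
      by split=> // /eqP ->.
    exists [ffun B : D => f (xchoose (exB B))].
      rewrite inE; apply/injectiveP=> B C; rewrite !ffunE => eqf.
      rewrite -(blkK B _ (xchooseP (exB B))) -(blkK C _ (xchooseP (exB C))).
      by apply/val_inj/eqP; rewrite /= eq_pblock ?covP ?inE // kerE eqf.
    apply/ffunP=> x; rewrite !ffunE; apply/eqP.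
    by rewrite -kerE; exact: (xchooseP (exB (blk x))).
  rewrite inE => /injectiveP inj_h ->; rewrite -[RHS](preim_partition_pblock partP).
  apply: eq_imset => x; apply/setP=> y; rewrite !inE /= !ffunE (inj_eq inj_h).
  by rewrite -(inj_eq val_inj).
by rewrite card_imset // card_inj_ffuns card_sig.
Qed.

(** The condition [g 0 = 1] discards the empty fibers; the other ones are the
    blocks of the kernel, each met once. *)
Lemma prod_fibers (g : nat -> nat) (T U : finType) (f : T -> U) : g 0%N = 1%N ->
  (\prod_(u : U) g #|[set x | f x == u]| =
     \prod_(B in preim_partition f [set: T]) g #|B|)%N.
Proof.
move=> g0; rewrite (bigID [in f @: [set: T]]) /= [X in (_ * X)%N]big1 ?muln1; last first.
  move=> u fu; rewrite (_ : [set x | _] = set0) ?cards0 //.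
  by apply/setP=> x; rewrite !inE; apply: contraNF fu => /eqP <-; rewrite imset_f.
rewrite (_ : preim_partition _ _ = [set [set x | f x == u] | u in f @: [set: T]]).
  rewrite [RHS]big_imset // => u v /imsetP[x _ ->] _ /setP/(_ x).
  by rewrite !inE eqxx => /esym/eqP.
rewrite -imset_comp; apply: eq_imset => x; apply/setP=> y.
by rewrite !inE eq_sym.
Qed.

(** The double count: group the maps by kernel, then the kernels by their number
    of blocks. *)
Lemma sum_ffun_prod_fibers (g : nat -> nat) (T U : finType) : g 0%N = 1%N ->
  (\sum_(f : {ffun T -> U}) \prod_(u : U) g #|[set x | f x == u]| =
     \sum_(k < #|T|.+1) weighted_partitions g T k * #|U| ^_ k)%N.
Proof.
move=> g0.
rewrite (partition_big (fun f : {ffun T -> U} => preim_partition f [set: T])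
  (fun P => partition P [set: T])) /=; last by move=> f _; exact: preim_partitionP.
transitivity (\sum_(P | partition P [set: T])
                #|U| ^_ #|P| * \prod_(B in P) g #|B|)%N.
  apply: eq_bigr => P partP; rewrite -(card_ffun_kernel T U P partP).
  rewrite -sum_nat_const; under [RHS]eq_bigl do rewrite inE.
  by apply: eq_bigr => f /eqP <-; rewrite prod_fibers.
pose size_of (P : {set {set T}}) : 'I_#|T|.+1 := inord #|P|.
have size_ofE P : partition P [set: T] -> size_of P = #|P| :> nat.
  by move=> /leq_card_partition leP; rewrite inordK // ltnS -cardsT.
rewrite (partition_big size_of predT) //=; apply: eq_bigr => k _.
rewrite /weighted_partitions big_distrl /=; apply: eq_big => P.
  by rewrite inE; apply: andb_id2l => partP; rewrite -val_eqE /= size_ofE.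
by case/andP=> partP /eqP <-; rewrite size_ofE // mulnC.
Qed.

(** * Ordered partitions as weighted set partitions *)

(** The type of lists of size at most [#|T|] contains every ordering of [B], so
    these lists are exactly the permutations of an enumeration of [B]. *)
Lemma card_orderings (T : finType) (B : {set T}) :
  #|[set s : #|T|.-bseq T | uniq s & [set x in s] == B]| = (#|B|)`!.
Proof.
rewrite cardE -(size_map val) cardE -size_permutations ?enum_uniq //.
apply/perm_size/uniq_perm; rewrite ?permutations_uniq //.
  by rewrite map_inj_uniq ?enum_uniq //; exact: val_inj.
move=> s; rewrite mem_permutations; apply/mapP/idP => [[t] | eqs].
  rewrite mem_enum inE => /andP[uniq_t /eqP <-] ->.
  by apply: uniq_perm => // [|x]; rewrite ?enum_uniq // mem_enum inE.
have le_s : (size s <= #|T|)%N by rewrite (perm_size eqs) -cardE max_card.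
exists (Bseq le_s) => //; rewrite mem_enum inE /= (perm_uniq eqs) enum_uniq /=.
by apply/eqP/setP=> x; rewrite inE (perm_mem eqs) mem_enum.
Qed.

Definition underlying_partition (T : finType) (Q : {set #|T|.-bseq T}) : {set {set T}} :=
  [set [set x in (s : #|T|.-bseq T)] | s in Q].

(** Injectivity says that no two lists of an ordered partition order the same
    block, so that forgetting the orders does not change the number of blocks:
    both lists would contain an element of that block, which lies in one list
    only. *)
Lemma ordered_partitions_underlying (T : finType) k (Q : {set #|T|.-bseq T}) :
  Q \in ordered_partitions T k ->
  {in Q &, injective (fun s : #|T|.-bseq T => [set x in s])}
  /\ underlying_partition T Q \in set_partitions T k.
Proof.
rewrite inE => /and3P[/forall_inP wfQ /forallP coverQ /eqP cardQ].
have uniqQ (s t : #|T|.-bseq T) x : s \in Q -> t \in Q -> x \in s -> x \in t -> s = t.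
  move=> Qs Qt xs xt; have /cards1P[r /setP eq1] := coverQ x.
  have := eq1 s; have := eq1 t; rewrite !inE Qs Qt xs xt /=.
  by move=> /esym/eqP -> /esym/eqP ->.
have neQ (s : #|T|.-bseq T) : s \in Q -> exists x, x \in s.
  case: s => -[|x s] sz /wfQ/andP[] // _ _; exists x; exact: mem_head.
have injQ : {in Q &, injective (fun s : #|T|.-bseq T => [set x in s])}.
  move=> s t Qs Qt /setP eqst; have [x xs] := neQ s Qs.
  by apply: (uniqQ s t x) => //; have := eqst x; rewrite !inE xs.
split=> //; rewrite inE card_in_imset // cardQ eqxx andbT; apply/and3P; split.
- apply/eqP/setP=> x; rewrite inE; apply/bigcupP.
  have /cards1P[s /setP/(_ s)] := coverQ x; rewrite !inE eqxx => /andP[Qs xs].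
  by exists [set y in s]; [apply: imset_f | rewrite inE].
- apply/trivIsetP=> _ _ /imsetP[s Qs ->] /imsetP[t Qt ->].
  apply: contraR => /pred0Pn[x /andP[]]; rewrite /= !inE => xs xt.
  by rewrite (uniqQ s t x).
- apply/imsetP=> -[s Qs /setP eq0]; have [x xs] := neQ s Qs.
  by have := eq0 x; rewrite !inE xs.
Qed.

(** An ordered partition over [P] amounts to an independent choice of one
    ordering for each block of [P]. Such choices are encoded as total functions
    on all subsets, with the empty list as value outside [P]. *)
Lemma card_ordered_partitions_over (T : finType) k (P : {set {set T}}) :
  P \in set_partitions T k ->
  #|[set Q in ordered_partitions T k | underlying_partition T Q == P]| =
    (\prod_(B in P) (#|B|)`!)%N.
Proof.
rewrite inE => /andP[partP /eqP cardP]; have [/eqP covP tiP P0] := and3P partP.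
pose O (B : {set T}) := [set s : #|T|.-bseq T | uniq s & [set x in s] == B].
pose nilb : #|T|.-bseq T := Bseq (leq0n _ : (size [::] <= #|T|)%N).
pose F := pfamily nilb P O.
have FO h B : h \in F -> B \in P -> uniq (h B) /\ [set x in h B] = B.
  by case/pfamilyP=> _ hO PB; have := hO B PB; rewrite inE => /andP[-> /eqP].
pose img (h : {ffun {set T} -> #|T|.-bseq T}) := [set h B | B in P].
transitivity #|[set img h | h in F]|; last first.
  rewrite card_in_imset.
    rewrite card_pfamily foldrE big_image; apply: eq_bigr => B _.
    exact: card_orderings.
  move=> h1 h2 F1 F2 /setP eqh; apply/ffunP=> B.
  have [PB | PB] := boolP (B \in P); last first.
    case/pfamilyP: F1 => /subsetP s1 _; case/pfamilyP: F2 => /subsetP s2 _.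
    have := contra (s1 B) PB; have := contra (s2 B) PB.
    by rewrite !inE !negbK => /eqP -> /eqP ->.
  have := eqh (h1 B); rewrite imset_f // => /esym/imsetP[C PC eqBC].
  have eqB : C = B by rewrite -(FO _ _ F1 PB).2 eqBC (FO _ _ F2 PC).2.
  by rewrite eqBC eqB.
apply: eq_card => Q; rewrite inE; apply/andP/imsetP.
  move=> [Qok /eqP suppQ]; have [injQ _] := ordered_partitions_underlying T k Q Qok.
  move: (Qok); rewrite inE => /and3P[/forall_inP wfQ _ _].
  pose h := [ffun B : {set T} =>
    odflt nilb [pick s in Q | (B \in P) && ([set x in s] == B)]].
  have hE (s : #|T|.-bseq T) : s \in Q -> h [set x in s] = s.
    move=> Qs; rewrite ffunE; case: pickP => [t /andP[Qt /andP[_ /eqP eqt]] | /(_ s)].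
      exact: injQ.
    by rewrite Qs eqxx -suppQ imset_f.
  exists h.
    apply/pfamilyP; split=> [|B].
      apply/subsetP=> B; rewrite inE; apply: contraR => /negbTE PB.
      by rewrite ffunE; case: pickP => // s; rewrite PB andbF.
    rewrite -suppQ => /imsetP[s Qs ->]; rewrite hE // inE eqxx andbT.
    by case/andP: (wfQ s Qs).
  apply/setP=> s; apply/idP/imsetP=> [Qs | [B]].
    by exists [set x in s]; rewrite ?hE // -suppQ imset_f.
  by rewrite -suppQ => /imsetP[t Qt ->] ->; rewrite hE.
case=> h Fh ->; have {}FO := FO h _ Fh.
have inj_h : {in P &, injective h}.
  by move=> B C PB PC eqh; rewrite -(FO B PB).2 eqh (FO C PC).2.
have supph : underlying_partition T (img h) = P.
  rewrite /underlying_partition -imset_comp -[RHS]imset_id.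
  by apply: eq_in_imset => B PB; case: (FO B PB).
split; last exact/eqP.
rewrite inE card_in_imset // cardP eqxx andbT; apply/andP; split.
  apply/forall_inP=> _ /imsetP[B PB ->]; have [-> eqB] := FO B PB.
  rewrite andbT; apply: contraNneq P0 => hB0; rewrite -(_ : B = set0) //.
  by rewrite -eqB; apply/setP=> x; rewrite !inE -[LHS]/(x \in (h B : seq T)) hB0.
apply/forallP=> x; have xP : x \in cover P by rewrite covP inE.
rewrite (_ : [set s in _ | _] = [set h (pblock P x)]) ?cards1 //.
have memh B : B \in P -> (x \in h B) = (x \in B).
  by move=> PB; rewrite -{2}(FO B PB).2 inE.
apply/setP=> s; rewrite !inE; apply/andP/eqP=> [[/imsetP[B PB ->]] | ->].
  by rewrite memh // => /(def_pblock tiP PB) ->.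
by rewrite imset_f ?memh ?pblock_mem // mem_pblock.
Qed.

Lemma card_ordered_partitions (T : finType) k :
  #|ordered_partitions T k| = weighted_partitions factorial T k.
Proof.
rewrite -sum1_card (partition_big (underlying_partition T) [in set_partitions T k]) /=; last first.
  by move=> Q /ordered_partitions_underlying[].
apply: eq_bigr => P Pok; rewrite sum1dep_card -(card_ordered_partitions_over T k P Pok).
by apply: eq_card => Q; rewrite !inE.
Qed.

Lemma stirling2E n k : stirling2 n k = weighted_partitions (fun=> 1%N) 'I_n k.
Proof.
by rewrite /weighted_partitions; under eq_bigr do rewrite big1_eq; rewrite sum1_card.
Qed.

(** * Expansions at natural numbers *)

(** Adding a new point to the source of [f] multiplies the product by the size,
    plus one, of the fiber that receives the point. Summed over the [m] possible
    fibers, these factors give [m + n], whatever [f] is. *)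
Lemma sum_ffun_prod_fact n m :
  (\sum_(f : {ffun 'I_n -> 'I_m}) \prod_(j < m) (#|[set i | f i == j]|)`! =
     \prod_(i < n) (m + i))%N.
Proof.
elim: n => [|n IHn].
  rewrite big_ord0 (big_pred1 [ffun i => False_rect _ (notF (valP i))]).
    rewrite big1 // => j _; rewrite (_ : [set i | _] = set0) ?cards0 //.
    by apply/setP=> -[].
  by move=> f; apply/esym/eqP/ffunP=> -[].
pose cons_ffun (p : 'I_m * {ffun 'I_n -> 'I_m}) : {ffun 'I_n.+1 -> 'I_m} :=
  [ffun i => oapp p.2 p.1 (unlift ord0 i)].
have cons0 p : cons_ffun p ord0 = p.1 by rewrite ffunE unlift_none.
have consS p i : cons_ffun p (lift ord0 i) = p.2 i by rewrite ffunE liftK.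
rewrite (reindex cons_ffun) /=; last first.
  exists (fun f => (f ord0, [ffun i => f (lift ord0 i)])) => [[j f] _ | f _].
    by rewrite cons0; congr (_, _); apply/ffunP=> i; rewrite ffunE consS.
  by apply/ffunP=> i; case: (unliftP ord0 i) => [i' ->|->]; rewrite ?consS ?cons0 ?ffunE.
have fiberE p j : #|[set i | cons_ffun p i == j]| =
    ((p.1 == j) + #|[set i | p.2 i == j]|)%N.
  rewrite -!sum1dep_card big_mkcond big_ord_recl cons0 [X in _ = (_ + X)%N]big_mkcond.
  rewrite /=; under eq_bigr do rewrite consS.
  by case: (p.1 == j).
rewrite -(pair_bigA _ (fun j f => \prod_(u < m) (#|[set i | cons_ffun (j, f) i == u]|)`!)%N) /=.
rewrite exchange_big big_ord_recr /= -IHn big_distrl /=; apply: eq_bigr => f _.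
transitivity (\sum_(j < m) (#|[set i | f i == j]|.+1 *
                            \prod_(u < m) (#|[set i | f i == u]|)`!))%N.
  apply: eq_bigr => j _; under eq_bigr do rewrite fiberE.
  rewrite (bigD1 j) //= eqxx add1n factS [in RHS](bigD1 j) //= !mulnA; congr (_ * _)%N.
  by apply: eq_bigr => u /negbTE; rewrite eq_sym => ->.
rewrite -big_distrl /= mulnC; congr (_ * _)%N.
under eq_bigr do rewrite -add1n; rewrite big_split /= sum1_card card_ord; congr (_ + _)%N.
under eq_bigr do rewrite -sum1dep_card big_mkcond.
rewrite exchange_big /= -[RHS]card_ord -sum1_card; apply: eq_bigr => i _.
by rewrite -big_mkcond (big_pred1 (f i)) // => j; rewrite eq_sym.
Qed.

Lemma stirling2_falling n m : (m ^ n = \sum_(k < n.+1) stirling2 n k * m ^_ k)%N.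
Proof.
have := sum_ffun_prod_fibers (fun=> 1%N) 'I_n 'I_m erefl.
under [X in X = _ -> _]eq_bigr do rewrite big1_eq.
rewrite sum1_card card_ffun !card_ord => ->.
by apply: eq_bigr => k _; rewrite stirling2E.
Qed.

Lemma lah_falling n m :
  (\prod_(i < n) (m + i) = \sum_(k < n.+1) lah n k * m ^_ k)%N.
Proof.
rewrite -sum_ffun_prod_fact (sum_ffun_prod_fibers factorial 'I_n 'I_m erefl) !card_ord.
by apply: eq_bigr => k _; rewrite /lah card_ordered_partitions.
Qed.

Lemma stirling2_small n k : (n < k)%N -> stirling2 n k = 0%N.
Proof. by move=> ltnk; rewrite stirling2E weighted_partitions_small ?card_ord. Qed.

Lemma lah_small n k : (n < k)%N -> lah n k = 0%N.
Proof.
by move=> ltnk; rewrite /lah card_ordered_partitions weighted_partitions_small ?card_ord.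
Qed.

(** * Polynomial expansions *)

Definition rising_poly (n : nat) : {poly int} := \prod_(i < n) ('X + (i%:Z)%:P).

Lemma eq_poly_on_nat (p q : {poly int}) :
  (forall m : nat, p.[m%:Z] = q.[m%:Z]) -> p = q.
Proof.
move=> eqpq; apply/eqP; rewrite -subr_eq0; apply/eqP.
apply: (@roots_geq_poly_eq0 _ _ [seq m%:Z | m <- iota 0 (size (p - q))]).
- by apply/allP=> _ /mapP[m _ ->]; rewrite rootE !hornerE eqpq subrr.
- by rewrite map_inj_uniq ?iota_uniq // => m1 m2 [].
- by rewrite size_map size_iota.
Qed.

Lemma horner_falling_poly n (m : nat) : (falling_poly n).[m%:Z] = (m ^_ n)%:Z.
Proof.
elim: n => [|n IHn]; first by rewrite /falling_poly big_ord0 hornerE.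
rewrite /falling_poly big_ord_recr hornerM -/(falling_poly n) IHn /= !hornerE.
rewrite ffactnSr PoszM; have [le_nm | lt_mn] := leqP n m; first by rewrite subzn.
by rewrite ffact_small // !mul0r.
Qed.

Lemma Xn_falling_poly n :
  'X^n = \sum_(k < n.+1) (stirling2 n k)%:Z *: falling_poly k.
Proof.
apply: eq_poly_on_nat => m; rewrite hornerXn horner_sum.
rewrite -[in LHS]natz -natrX stirling2_falling natr_sum; apply: eq_bigr => k _.
by rewrite hornerZ horner_falling_poly natrM !natz.
Qed.

Lemma rising_falling_poly n :
  rising_poly n = \sum_(k < n.+1) (lah n k)%:Z *: falling_poly k.
Proof.
apply: eq_poly_on_nat => m; rewrite horner_prod horner_sum.
transitivity ((\prod_(i < n) (m + i))%N%:Z).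
  by rewrite -[RHS]natz natr_prod; apply: eq_bigr => i _; rewrite !hornerE natz PoszD.
rewrite lah_falling -[LHS]natz natr_sum; apply: eq_bigr => k _.
by rewrite hornerZ horner_falling_poly natrM !natz.
Qed.

Lemma falling_poly_reflect n : falling_poly n \Po - 'X = (-1) ^+ n *: rising_poly n.
Proof.
rewrite /falling_poly /rising_poly rmorph_prod /=.
elim: n => [|n IHn]; first by rewrite !big_ord0 expr0 scale1r.
rewrite !big_ord_recr /= IHn exprS -!mul_polyC mulN1r polyCN mulNr mulrA -mulrN.
by congr (_ * _); rewrite rmorphB /= comp_polyX comp_polyC opprD.
Qed.

Lemma signr_sub n l : (l <= n)%N -> (-1) ^+ n * (-1) ^+ l = (-1) ^+ (n - l) :> int.
Proof.
by move=> le_ln; rewrite -signr_odd -[(-1) ^+ l]signr_odd -signr_addb -oddB // signr_odd.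
Qed.

Lemma exprNX l : (- 'X) ^+ l = (-1) ^+ l *: 'X^l :> {poly int}.
Proof. by rewrite -mul_polyC polyC_exp polyCN -exprMn mulN1r. Qed.

Lemma rising_polyE n :
  rising_poly n = \sum_(l < n.+1) ((-1) ^+ (n - l) * stirling1 n l) *: 'X^l.
Proof.
have -> : rising_poly n = (-1) ^+ n *: (falling_poly n \Po - 'X).
  by rewrite falling_poly_reflect scalerA -expr2 sqrr_sign scale1r.
rewrite comp_polyE scaler_sumr.
have -> : size (falling_poly n) = n.+1.
  by rewrite size_prod_XsubC /index_enum -enumT size_enum_ord.
apply: eq_bigr => -[l /= le_ln] _; rewrite -/(stirling1 n l) exprNX !scalerA.
congr (_ *: _); rewrite mulrAC; congr (_ * _).
exact: signr_sub.
Qed.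

Lemma Xn_rising_poly n :
  'X^n = \sum_(l < n.+1) ((-1) ^+ (n - l) * (stirling2 n l)%:Z) *: rising_poly l.
Proof.
have -> : 'X^n = (-1) ^+ n *: ('X^n \Po - 'X) :> {poly int}.
  by rewrite comp_Xn_poly exprNX scalerA -expr2 sqrr_sign scale1r.
rewrite Xn_falling_poly raddf_sum scaler_sumr.
apply: eq_bigr => -[l /= le_ln] _; rewrite comp_polyZ falling_poly_reflect !scalerA.
by congr (_ *: _); rewrite mulrAC signr_sub.
Qed.

(** The degrees of the falling factorials are distinct and their leading
    coefficients are 1, so the top coefficient is determined, then the next. *)
Lemma falling_poly_free n (c d : nat -> int) :
  \sum_(k < n) c k *: falling_poly k = \sum_(k < n) d k *: falling_poly k ->
  forall k, (k < n)%N -> c k = d k.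
Proof.
elim: n => // n IHn eqcd.
have size_falling k : size (falling_poly k) = k.+1.
  by rewrite size_prod_XsubC /index_enum -enumT size_enum_ord.
have top (a : nat -> int) : (\sum_(k < n.+1) a k *: falling_poly k)`_n = a n.
  rewrite big_ord_recr /= coefD coef_sum big1 => [|i _].
    rewrite add0r coefZ -[X in _`_X]/(n.+1.-1) -size_falling -lead_coefE.
    by rewrite (monicP (monic_prod_XsubC _ _ _)) mulr1.
  by rewrite coefZ nth_default ?mulr0 // size_falling.
have eqn : c n = d n by rewrite -(top c) eqcd top.
move: eqcd; rewrite !big_ord_recr /= eqn => /addIr/IHn eqlt k.
by rewrite ltnS leq_eqVlt => /predU1P[-> | /eqlt].
Qed.

(** Substituting a triangular expansion into another sum. Extending the inner
    sums to the common range [j < n.+1], by zero terms, makes them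
    exchangeable. *)
Lemma falling_poly_subst n (a : nat -> int) (b : nat -> nat -> nat) :
  (forall l j, (l < j)%N -> b l j = 0%N) ->
  \sum_(l < n.+1) a l *: (\sum_(j < l.+1) (b l j)%:Z *: falling_poly j) =
  \sum_(j < n.+1) (\sum_(l < n.+1) a l * (b l j)%:Z) *: falling_poly j.
Proof.
move=> b0; under [RHS]eq_bigr do rewrite scaler_suml.
rewrite exchange_big; apply: eq_bigr => l _.
rewrite (big_ord_widen n.+1 (fun j => (b l j)%:Z *: falling_poly j) (ltn_ord l)).
rewrite scaler_sumr big_mkcond; apply: eq_bigr => j _.
rewrite ltnS scalerA; case: leqP => // /b0 ->.
by rewrite mulr0 scale0r.
Qed.

Theorem theorem8 (n k : nat) (hkn : (k <= n)%N) :
  (stirling2 n k)%:Z =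
    \sum_(k <= l < n.+1) (-1) ^+ (n - l)%N * (stirling2 n l)%:Z * (lah l k)%:Z
  /\
  (lah n k)%:Z =
    \sum_(k <= l < n.+1) (-1) ^+ (n - l)%N * stirling1 n l * (stirling2 l k)%:Z.
Proof.
have extend (a b : nat -> int) : (forall l, (l < k)%N -> b l = 0) ->
    \sum_(k <= l < n.+1) a l * b l = \sum_(l < n.+1) a l * b l.
  move=> b0; rewrite -(big_mkord predT (fun l => a l * b l)).
  rewrite [RHS](big_cat_nat (leq0n k) (leqW hkn)) /=.
  rewrite [X in _ = X + _]big_nat_cond [X in _ = X + _]big1 ?add0r // => l.
  by move=> /andP[/andP[_ /b0 ->] _]; rewrite mulr0.
split; rewrite extend.
- pose a l := (-1) ^+ (n - l) * (stirling2 n l)%:Z.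
  apply: (falling_poly_free n.+1 (fun j => (stirling2 n j)%:Z)
            (fun j => \sum_(l < n.+1) a l * (lah l j)%:Z)); last by rewrite ltnS.
  rewrite -Xn_falling_poly -(falling_poly_subst n a lah lah_small) Xn_rising_poly.
  by apply: eq_bigr => l _; rewrite -rising_falling_poly.
- by move=> l /lah_small ->.
- pose a l := (-1) ^+ (n - l) * stirling1 n l.
  apply: (falling_poly_free n.+1 (fun j => (lah n j)%:Z)
            (fun j => \sum_(l < n.+1) a l * (stirling2 l j)%:Z)); last by rewrite ltnS.
  rewrite -rising_falling_poly -(falling_poly_subst n a stirling2 stirling2_small).
  by rewrite rising_polyE; apply: eq_bigr => l _; rewrite -Xn_falling_poly.
- by move=> l /stirling2_small ->.
Qed.
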